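(* Let $n\in\mathbb{N}$, let $f_i:=\sum_{|\alpha|\le d_i}a_{i\alpha}\mathbf{x}^\alpha\in K[\mathbf{x}]=K[x_1,\dots,x_n]$ for $1\le i\le n+1$ be generic polynomials of degrees $d_1,\dots,d_{n+1}$ respectively, where the $a_{i\alpha}$ ($1\le i\le n+1$, $\alpha\in(\mathbb{Z}_{\ge0})^n$, $|\alpha|\le d_i$) are algebraically independent variables over $\mathbb{Q}$ and $K:=\mathbb{Q}(a_{i\alpha})$ is the field generated by all of them. Let $\mathbf{d}:=d_1\cdots d_n$ and let $\{\xi_1,\dots,\xi_{\mathbf{d}}\}$ be the set of common roots of $f_1,\dots,f_n$ in $\overline K^n$. Let $\mathcal{T}=\bigcup_{j\ge0}\mathcal{T}_j=\{\mathbf{x}^{\alpha_1},\dots,\mathbf{x}^{\alpha_{\mathbf{d}}}\}$ be a set of monomials as described in the context, with $\mathcal{T}^*=\{\mathbf{x}^{\alpha_1},\dots,\mathbf{x}^{\alpha_s}\}$ its first $s$ elements, let $\mathcal{R}_{n+1}=\{\mathbf{x}^{\beta_1},\dots,\mathbf{x}^{\beta_r}\}$, and let $\mathcal{V}_{\mathcal{T}}:=\det(\xi_j^{\alpha_i})_{1\le i,j\le\mathbf{d}}$. Then, for any $t\in\mathbb{Z}_{\ge0}$ and for any set $\mathcal{S}=\{\mathbf{x}^{\gamma_1},\dots,\mathbf{x}^{\gamma_k}\}\subset K[\mathbf{x}]_t$ of monomials, of cardinality $k=\mathcal{H}_{d_1\dots d_{n+1}}(t)$, the order $t$ subresultant $\Delta_{\mathcal{S}}$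 satisfies $$\Delta_{\mathcal{S}}=\pm\left(\prod_{j=t-d_{n+1}+1}^{t}\overline\Delta_{\mathcal{T}_j}\right)\frac{|\mathcal{O}_{\mathcal{S}}|}{\mathcal{V}_{\mathcal{T}}},$$ where $|\cdot|$ denotes the determinant and $$\mathcal{O}_{\mathcal{S}}=\left[\begin{array}{ccc} \xi_1^{\gamma_1}&\cdots&\xi_{\mathbf{d}}^{\gamma_1}\\ \vdots&&\vdots\\ \xi_1^{\gamma_k}&\cdots&\xi_{\mathbf{d}}^{\gamma_k}\\ \hline \xi_1^{\alpha_1}&\cdots&\xi_{\mathbf{d}}^{\alpha_1}\\ \vdots&&\vdots\\ \xi_1^{\alpha_s}&\cdots&\xi_{\mathbf{d}}^{\alpha_s}\\ \hline \xi_1^{\beta_1}f_{n+1}(\xi_1)&\cdots&\xi_{\mathbf{d}}^{\beta_1}f_{n+1}(\xi_{\mathbf{d}})\\ \vdots&&\vdots\\ \xi_1^{\beta_r}f_{n+1}(\xi_1)&\cdots&\xi_{\mathbf{d}}^{\beta_r}f_{n+1}(\xi_{\mathbf{d}}) \end{array}\right]\in\overline K^{\mathbf{d}\times\mathbf{d}}.$$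
   Context: Notation. $\mathbf{x}^\alpha:=x_1^{\alpha_1}\cdots x_n^{\alpha_n}$, $|\alpha|:=\alpha_1+\cdots+\alpha_n$; for $\xi\in\overline K^n$, $\xi^\alpha$ is the value of $\mathbf{x}^\alpha$ at $\xi$. $\overline K$ is the algebraic closure of $K$. The polynomials $f_1,\dots,f_n$ have $\mathbf{d}=d_1\cdots d_n$ common roots in $\overline K^n$ (the Bézout number). $K[\mathbf{x}]_j$ is the space of polynomials of degree at most $j$, together with $0$. Numbers. $\rho:=(d_1-1)+\cdots+(d_n-1)$, $t^*:=\max\{\rho,t\}$. $k=\mathcal{H}_{d_1\dots d_{n+1}}(t)$ is the Hilbert function at $t$ of a regular sequence of $n+1$ homogeneous polynomials in $n+1$ variables of degrees $d_1,\dots,d_{n+1}$, i.e. $k=\#\{\mathbf{x}^\alpha:|\alpha|\le t,\ \alpha_i<d_i\ (1\le i\le n),\ t-|\alpha|<d_{n+1}\}$. For $j\ge0$, $\tau_j:=\mathcal{H}_{d_1\dots d_n}(j)$ is the Hilbert function at $j$ of a regular sequence of $n$ homogeneous polynomials in $n$ variables of degrees $d_1,\dots,d_n$, i.e. $\tau_j=\#\{\mathbf{x}^\alpha:|\alpha|=j,\ \alpha_i<d_i\ (1\le i\le n)\}$; so $\tau_j=0$ for $j>\rho$. Sets of monomials. For $1\le i\le n+1$, $\mathcal{R}_i:=\{\mathbf{x}^\alpha:|\alpha|\le t-d_i,\ \alpha_j<d_j\text{ for }j<i\}$, and $r:=\#\mathcal{R}_{n+1}$. For $j\ge\max\{0,t-d_{n+1}+1\}$,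 $\mathcal{T}_j$ is any set of $\tau_j$ monomials of degree $j$ in $x_1,\dots,x_n$; for $0\le j<t-d_{n+1}+1$, $\mathcal{T}_j:=\{\mathbf{x}^\alpha:|\alpha|=j,\ \alpha_i<d_i\ (1\le i\le n)\}$. $\mathcal{T}:=\bigcup_{j\ge0}\mathcal{T}_j$ (it has $\mathbf{d}$ elements), $\mathcal{T}^*:=\bigcup_{j=t+1}^{t^*}\mathcal{T}_j$ and $s:=\#\mathcal{T}^*$ ($\mathcal{T}^*=\emptyset$ if $t\ge\rho$). The elements of $\mathcal{T}$ are numbered so that those of $\mathcal{T}^*$ come first. $\mathcal{V}_{\mathcal{T}}$ is called the generalized Vandermonde determinant associated to $\mathcal{T}$. Order $t$ subresultant $\Delta_{\mathcal{S}}$. This is Chardin's order $t$ subresultant of the homogenizations $f_1^h,\dots,f_{n+1}^h$ (with homogenizing variable $x_{n+1}$) with respect to $\mathcal{S}^h:=\{\mathbf{x}^{\gamma_1}x_{n+1}^{t-|\gamma_1|},\dots,\mathbf{x}^{\gamma_k}x_{n+1}^{t-|\gamma_k|}\}$. It is given by $$\Delta_{\mathcal{S}}=\pm\frac{|\widetilde M_{\mathcal{S}}|}{\mathcal{E}(t)},$$ where the following notation is used. Let $N:=\binom{t+n}{n}=\dim_K K[\mathbf{x}]_t$; one has $N=k+\#\mathcal{R}_1+\cdots+\#\mathcal{R}_{n+1}$. Let $M$ be the matrix whose rows are indexed by the pairs $(i,\mathbf{x}^\alpha)$ with $1\le i\le n+1$, $\mathbf{x}^\alpha\in\mathcal{R}_i$,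 whose columns are indexed by the monomials of degree at most $t$ together with those of $\mathcal{T}^*$, and whose row $(i,\mathbf{x}^\alpha)$ is the coefficient vector of $\mathbf{x}^\alpha f_i$. The Macaulay-Chardin matrix $\widetilde M_{\mathcal{S}}$ is the $(N-k)\times(N-k)$ matrix obtained from $M$ by deleting the columns indexed by $\mathcal{S}\cup\mathcal{T}^*$. The extraneous factor $\mathcal{E}(t)$ is the determinant of the square submatrix of $M$ whose rows are the $(i,\mathbf{x}^\alpha)$ with $1\le i\le n$, $\mathbf{x}^\alpha\in\mathcal{R}_i$, such that $t-d_i-|\alpha|\ge d_{n+1}$ or there exists $j>i$ with $\alpha_j\ge d_j$, and whose columns are the monomials $\mathbf{x}^\alpha$ of degree at most $t$ such that $t-|\alpha|\ge d_{n+1}$ and $\alpha_i\ge d_i$ for some index $i$, or such that there are at least two different indices $1\le i,j\le n$ with $\alpha_i\ge d_i$ and $\alpha_j\ge d_j$. Subresultants $\overline\Delta_{\mathcal{T}_j}$. For $1\le i\le n$ let $\overline f_i$ be the homogeneous component of degree $d_i$ of $f_i$. Then $\overline\Delta_{\mathcal{T}_j}$ is the order $j$ subresultant of the $n$ homogeneous polynomials $\overline f_1,\dots,\overline f_n$ in $n$ variables with respect to $\mathcal{T}_j$; up to sign it is $|M_j|/\mathcal{E}_j$, where $M_j$ is the square matrix with rows indexed by the pairs $(i,\mathbf{x}^\alpha)$, $1\le i\le n$, $|\alpha|=j-d_i$, $\alpha_l<d_l$ for $l<i$, with columns indexed by the monomials of degree $j$ in $x_1,\dots,x_n$ not in $\mathcal{T}_j$,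 and with row $(i,\mathbf{x}^\alpha)$ consisting of the corresponding coefficients of $\mathbf{x}^\alpha\overline f_i$; and $\mathcal{E}_j$ is the extraneous factor of this construction (depending on $j$ but not on the set $\mathcal{T}_j$), namely the determinant of the square matrix of coefficients of the $\mathbf{x}^\alpha\overline f_i$ with rows those $(i,\mathbf{x}^\alpha)$ as before for which there exists $l>i$ with $\alpha_l\ge d_l$, and columns the monomials $\mathbf{x}^\alpha$ of degree $j$ with $\alpha_i\ge d_i$ for at least two different indices $i\in\{1,\dots,n\}$.
   Formalization: The degrees are taken positive, and the quotient formula is stated when the generalized Vandermonde determinant V_T is nonzero (it can vanish for some admissible T); for every T the identity multiplied through by V_T is stated, with the same sign. *)

(* Defs.v *)
From mathcomp Require Import all_boot all_order all_algebra.
From mathcomp Require Import mpoly.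

Set Implicit Arguments.
Unset Strict Implicit.
Unset Printing Implicit Defensive.

Import GRing.Theory.
Local Open Scope ring_scope.

(* Conventions.
   - Indices are shifted by one: the polynomials are indexed by i : 'I_n.+1, the
     last one by ord_max, and the variables by j : 'I_n.
   - Degree conditions such as |a| <= t - d_i are written |a| + d_i <= t, since
     subtraction on nat is truncated.
   - Sets of monomials and of row labels are listed in the order of their finType
     enumeration. Any other numbering permutes rows or columns, so it changes the
     determinants below by a sign only. *)

Section Determinants.

(* The determinant of a matrix whose two sizes are equal, though not
   convertible. All matrices to which it is applied below are square; for sizes
   that differ it would be the determinant of a zero matrix. *)
Definition sqdet (R : comNzRingType) (p q : nat) (A : 'M[R]_(p, q)) : R :=
  \det (conform_mx (0 : 'M[R]_p) A).

Variables (R : nzRingType) (n b : nat) (I : finType) (g : I -> {mpoly R[n]}).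

(* Coefficients of the x^a g_i at the monomials in C, for (i, x^a) in A. *)
Definition coef_mx (A : {set I * 'X_{1..n < b}}) (C : {set 'X_{1..n < b}}) :
    'M[R]_(#|A|, #|C|) :=
  \matrix_(u < #|A|, v < #|C|)
     ('X_[(enum_val u).2] * g (enum_val u).1)@_(enum_val v : 'X_{1..n < b}).

End Determinants.

Section Generic.

Variables (n : nat) (d : 'I_n.+1 -> nat).

Definition coef_index := {i : 'I_n.+1 & 'X_{1..n < (d i).+1}}.

(* K = Q(a_{i,alpha}) *)
Definition genK := {fraction {mpoly rat[#|{: coef_index}|]}}.

Definition gen_coef (i : 'I_n.+1) (m : 'X_{1..n < (d i).+1}) : genK :=
  tofrac 'X_(enum_rank (Tagged (fun i => 'X_{1..n < (d i).+1}) m : coef_index)).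

Definition gen_poly (i : 'I_n.+1) : {mpoly genK[n]} :=
  \sum_(m : 'X_{1..n < (d i).+1}) gen_coef m *: 'X_[m].

(* The index of the polynomial attached to the j-th variable, as in a_j < d_j. *)
Definition ix (j : 'I_n) : 'I_n.+1 := widen_ord (leqnSn n) j.

Definition gen_top (i : 'I_n) : {mpoly genK[n]} :=
  pihomog mdeg (d (ix i)) (gen_poly (ix i)).

Definition bezout : nat := (\prod_(j < n) d (ix j))%N.

Definition rho : nat := (\sum_(j < n) (d (ix j)).-1)%N.

Definition reduced (m : 'X_{1..n}) : bool :=
  [forall j : 'I_n, (m j < d (ix j))%N].

(* H_{d_1...d_{n+1}}(t) *)
Definition hilb_all (t : nat) : nat :=
  #|[set m : 'X_{1..n < t.+1} | reduced m & (t - mdeg m < d ord_max)%N]|.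

(* tau_j = H_{d_1...d_n}(j) *)
Definition tau (j : nat) : nat :=
  #|[set m : 'X_{1..n < j.+1} | (mdeg m == j) && reduced m]|.

Variable t : nat.

Definition tstar : nat := maxn rho t.

(* Every monomial in the construction has degree at most tstar: for j > rho,
   tau_j = 0 and hence T_j is empty. *)
Local Notation mon := 'X_{1..n < tstar.+1}.

Definition Rset (i : 'I_n.+1) : {set mon} :=
  [set m : mon | (mdeg m + d i <= t)%N
               & [forall j : 'I_n, (j < i)%N ==> (m j < d (ix j))%N]].

Definition admissible (T : nat -> {set mon}) : Prop :=
  forall j : nat,
    [/\ forall m, m \in T j -> mdeg m = j,
        #|T j| = tau j
      & (j + d ord_max <= t)%N ->
        T j = [set m : mon | (mdeg m == j) && reduced m]].

Definition Tall (T : nat -> {set mon}) : {set mon} :=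
  \bigcup_(0 <= j < tstar.+1) T j.

Definition Tstar (T : nat -> {set mon}) : {set mon} :=
  \bigcup_(t.+1 <= j < tstar.+1) T j.

(* The subresultant Delta_S, up to sign. *)

Definition rows_M : {set 'I_n.+1 * mon} := [set p | p.2 \in Rset p.1].

Definition cols_M (S : {set mon}) : {set mon} :=
  [set m : mon | (mdeg m <= t)%N & m \notin S].

Definition rows_E : {set 'I_n.+1 * mon} :=
  [set p in rows_M | (p.1 < n)%N &
     (d ord_max <= t - d p.1 - mdeg p.2)%N ||
     [exists j : 'I_n, (p.1 < j)%N && (d (ix j) <= p.2 j)%N]].

Definition cols_E : {set mon} :=
  [set m : mon | (mdeg m <= t)%N &
     ((d ord_max <= t - mdeg m)%N &&
        [exists i : 'I_n, (d (ix i) <= m i)%N]) ||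
     [exists i : 'I_n, exists j : 'I_n,
        [&& i != j, (d (ix i) <= m i)%N & (d (ix j) <= m j)%N]]].

Definition extraneous : genK := sqdet (coef_mx gen_poly rows_E cols_E).

Definition Delta (S : {set mon}) : genK :=
  sqdet (coef_mx gen_poly rows_M (cols_M S)) / extraneous.

(* The order j subresultant of the top forms with respect to T_j, up to sign. *)

Definition rows_top (j : nat) : {set 'I_n * mon} :=
  [set p : 'I_n * mon | (mdeg p.2 + d (ix p.1) == j)%N &
     [forall l : 'I_n, (l < p.1)%N ==> (p.2 l < d (ix l))%N]].

Definition cols_top (j : nat) (Tj : {set mon}) : {set mon} :=
  [set m : mon | mdeg m == j & m \notin Tj].

Definition rows_Etop (j : nat) : {set 'I_n * mon} :=
  [set p in rows_top j |
     [exists l : 'I_n, (p.1 < l)%N && (d (ix l) <= p.2 l)%N]].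

Definition cols_Etop (j : nat) : {set mon} :=
  [set m : mon | mdeg m == j &
     [exists i : 'I_n, exists l : 'I_n,
        [&& i != l, (d (ix i) <= m i)%N & (d (ix l) <= m l)%N]]].

Definition extraneous_top (j : nat) : genK :=
  sqdet (coef_mx gen_top (rows_Etop j) (cols_Etop j)).

Definition Delta_top (j : nat) (Tj : {set mon}) : genK :=
  sqdet (coef_mx gen_top (rows_top j) (cols_top j Tj)) / extraneous_top j.

End Generic.

Section Roots.

Variables (n : nat) (d : 'I_n.+1 -> nat) (t : nat).
Local Notation mon := 'X_{1..n < (tstar d t).+1}.
Variables (L : closedFieldType) (iota : {rmorphism genK d -> L}).
Variable xi : 'I_(bezout d) -> {ffun 'I_n -> L}.

Definition evalK (p : {mpoly (genK d)[n]}) (x : {ffun 'I_n -> L}) : L :=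
  (map_mpoly iota p).@[x].

(* xi lists without repetition the common roots of f_1, ..., f_n in L^n. *)
Definition lists_common_roots : Prop :=
  injective xi /\
  forall x : {ffun 'I_n -> L},
    (forall i : 'I_n, evalK (gen_poly d (ix i)) x = 0) <->
    exists j, x = xi j.

Definition mon_rows (A : {set mon}) : 'M[L]_(#|A|, bezout d) :=
  \matrix_(u < #|A|, j < bezout d) ('X_[(enum_val u : mon)]).@[xi j].

(* Generalized Vandermonde determinant; the elements of Tstar come first.
   It can be zero: for (d_1, d_2, d_3) = (1, 3, 3) and t = 1, d_4 = 2, take
   T_2 = {x_1^2, x_1 x_2, x_1 x_3}. Modulo the top form of f_1 these are a
   linear form times three elements of a two-dimensional space. *)
Definition vandermonde (T : nat -> {set mon}) : L :=
  sqdet (col_mx (mon_rows (Tstar T)) (mon_rows (Tall T :\: Tstar T))).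

Definition f_rows :
    'M[L]_(#|@Rset n d t ord_max|, bezout d) :=
  \matrix_(u, j)
     (('X_[(enum_val u : mon)]).@[xi j] * evalK (gen_poly d ord_max) (xi j)).

Definition O_mx (S : {set mon}) (T : nat -> {set mon}) :=
  col_mx (mon_rows S) (col_mx (mon_rows (Tstar T)) f_rows).

End Roots.

(* Main.v *)
Require Import Defs.
From mathcomp Require Import all_boot all_order all_algebra.
From mathcomp Require Import mpoly.
From mathcomp Require Import perm zify.

Set Implicit Arguments.
Unset Strict Implicit.
Unset Printing Implicit Defensive.

Import GRing.Theory.
Local Open Scope ring_scope.

(* Complete the rows of M by unit rows at the monomials of S and T* to a square
   matrix, and multiply it by the square matrix whose columns are the values of
   the monomials at the roots, completed by unit columns at the monomials of
   degree at most t outside T. The rows of f_1, ..., f_n vanish at the roots, so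
   the product is block triangular, and
     |M_S| V_T = +- |O_S| |M'|,
   where M' has as rows those of f_1, ..., f_n and as columns the monomials of
   degree at most t outside T. Since deg (x^a f_i) = |a| + d_i, both M' and the
   matrix of E(t) are block triangular for the degree j, with the following
   diagonal blocks: M_j for M'; M_j if j <= t - d_{n+1}, and that of E_j
   otherwise, for E(t). So |M'| / E(t) is the product of the Delta_{T_j} over
   t - d_{n+1} < j <= t, once |M_j| <> 0 for j <= t - d_{n+1}. There T_j consists
   of the reduced monomials, and specializing f_i to x_i^{d_i} turns M_j into a
   permutation matrix. *)

(** * Determinants up to sign *)

(** The exponent is a Boolean, so signs compose by exclusive or. Changing the numbering of rows and
    columns stays within this relation. *)
Definition eq_sign (R : pzRingType) (x y : R) := exists e : bool, x = (-1) ^+ e * y.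

Notation "x =± y" := (eq_sign x y) (at level 70).

Section EqSign.

Variable R : comPzRingType.
Implicit Types x y z : R.

Lemma eq_sign_refl x : x =± x.
Proof. by exists false; rewrite expr0 mul1r. Qed.

Lemma eq_signW x y : x = y -> x =± y.
Proof. by move=> ->; apply: eq_sign_refl. Qed.

Lemma eq_sign_sym x y : x =± y -> y =± x.
Proof. by case=> e ->; exists e; rewrite mulrA -signr_addb addbb expr0 mul1r. Qed.

Lemma eq_sign_trans y x z : x =± y -> y =± z -> x =± z.
Proof.
by case=> e -> [e' ->]; exists (e (+) e'); rewrite mulrA -signr_addb.
Qed.

Lemma eq_signM x x' y y' : x =± x' -> y =± y' -> x * y =± x' * y'.
Proof.
by case=> e -> [e' ->]; exists (e (+) e'); rewrite mulrACA -signr_addb.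
Qed.

Lemma eq_sign_prod (I : Type) (s : seq I) (P : pred I) (F G : I -> R) :
  (forall i, P i -> F i =± G i) ->
  \prod_(i <- s | P i) F i =± \prod_(i <- s | P i) G i.
Proof.
move=> FG; elim/big_rec2: _ => [|i x y Pi]; first exact: eq_sign_refl.
by apply: eq_signM; apply: FG.
Qed.

End EqSign.

Lemma eq_signV (F : fieldType) (x y : F) : x =± y -> x^-1 =± y^-1.
Proof. by case=> e ->; exists e; rewrite invfM -exprVn invrN1. Qed.

Lemma rmorph_eq_sign (R R' : pzRingType) (f : {rmorphism R -> R'}) x y :
  x =± y -> f x =± f y.
Proof. by case=> e ->; exists e; rewrite rmorphM rmorph_sign. Qed.

(** * Determinants of matrices whose sizes are provably equal *)

Section SquareDet.

Variable R : comNzRingType.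

Lemma sqdetE p (A : 'M[R]_p) : sqdet A = \det A.
Proof. by rewrite /sqdet conform_mx_id. Qed.

(** The bijections make the sizes agree, and then [M] is [M'] with rows and columns permuted. *)
Lemma sqdet_perm p q p' q' (M : 'M[R]_(p, q)) (M' : 'M_(p', q'))
    (f : 'I_p -> 'I_p') (g : 'I_q -> 'I_q') :
    bijective f -> bijective g -> (forall u v, M u v = M' (f u) (g v)) ->
  sqdet M =± sqdet M'.
Proof.
move=> bf bg.
have ep : p' = p by rewrite -[p]card_ord -[p']card_ord (bij_eq_card bf).
have eq : q' = q by rewrite -[q]card_ord -[q']card_ord (bij_eq_card bg).
move: M' f bf g bg; rewrite ep eq => {p' q' ep eq} M' f bf g bg MM'.
(* If [q] differs from [p], both sides are the determinant of the zero matrix of size [p]. *)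
have [epq|npq] := eqVneq q p; last first.
  by rewrite /sqdet !nonconform_mx ?eqxx 1?npq //; apply: eq_sign_refl.
move: M M' g bg MM'; rewrite epq => {q epq} M M' g bg MM'.
have fi := bij_inj bf; have gi := bij_inj bg.
rewrite !sqdetE.
have -> : M = row_perm (perm fi) (col_perm (perm gi) M').
  by apply/matrixP => u v; rewrite MM' !mxE !permE.
rewrite row_permE col_permE !det_mulmx !det_perm.
apply: (@eq_sign_trans _ (1 * (\det M' * 1))); last first.
  by rewrite mul1r mulr1; apply: eq_sign_refl.
apply: eq_signM; first by exists (odd_perm (perm fi)); rewrite mulr1.
apply: eq_signM; first exact: eq_sign_refl.
by eexists; rewrite mulr1.
Qed.

Lemma sqdet_ublock p1 p2 q1 q2 (A : 'M[R]_(p1, q1)) B (D : 'M_(p2, q2)) :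
  p1 = q1 -> p2 = q2 -> sqdet (block_mx A B 0 D) = sqdet A * sqdet D.
Proof. by move=> e1 e2; subst q1 q2; rewrite !sqdetE det_ublock. Qed.

Lemma sqdet_mul p q r (A : 'M[R]_(p, q)) (B : 'M_(q, r)) :
  p = q -> q = r -> sqdet (A *m B) = sqdet A * sqdet B.
Proof. by move=> e1 e2; subst q r; rewrite !sqdetE det_mulmx. Qed.

Lemma sqdet_map (R' : comNzRingType) (f : {rmorphism R -> R'}) p q
    (A : 'M[R]_(p, q)) : sqdet (map_mx f A) = f (sqdet A).
Proof. by rewrite /sqdet -det_map_mx map_conform_mx map_mx0. Qed.

End SquareDet.

(** * Disjoint unions and numberings of finite sets *)

Section DisjointSum.

Variables I J : finType.
Implicit Types (A : {set I}) (B : {set J}).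

Lemma inl_inj : injective (@inl I J). Proof. by move=> i j []. Qed.

Lemma inr_inj : injective (@inr I J). Proof. by move=> i j []. Qed.

Lemma disjoint_inr_inl A B : [disjoint (inr @: B : {set I + J}) & inl @: A].
Proof.
by rewrite -setI_eq0; apply/eqP/setP => -[i|i]; rewrite !inE;
  apply/andP => -[/imsetP[? _ e] /imsetP[? _ e']].
Qed.

Lemma card_inl A : #|inl @: A : {set I + J}| = #|A|.
Proof. exact/card_imset/inl_inj. Qed.

Lemma card_inr B : #|inr @: B : {set I + J}| = #|B|.
Proof. exact/card_imset/inr_inj. Qed.

End DisjointSum.

(** The ordinal is not fixed to be that of [#|A|]: block matrices carry sizes such as [p + q], and
    the equality with [#|A|] is a consequence. *)
Definition enumerates (I : finType) (A : {set I}) p (f : 'I_p -> I) :=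
  injective f /\ f @: setT = A.

Definition split_case (I : Type) p q (f : 'I_p -> I) (g : 'I_q -> I)
    (u : 'I_(p + q)) : I :=
  match split u with inl v => f v | inr v => g v end.

Section Enumerates.

Variable I : finType.
Implicit Type A : {set I}.

Lemma enumerates_card A p (f : 'I_p -> I) : enumerates A f -> #|A| = p.
Proof. by case=> fi <-; rewrite card_imset // cardsT card_ord. Qed.

Lemma enumerates_enum_val A : enumerates A (@enum_val I (mem A)).
Proof.
split; first exact: enum_val_inj.
apply/setP => x; apply/imsetP/idP => [[u _ ->]|xA]; first exact: enum_valP.
by exists (enum_rank_in xA x); rewrite ?inE ?enum_rankK_in.
Qed.

Lemma enumerates_ord p : enumerates setT (id : 'I_p -> 'I_p).
Proof. by split=> //; rewrite imset_id. Qed.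

Lemma enumerates_comp (J : finType) A p (f : 'I_p -> I) (g : I -> J) :
  enumerates A f -> {in A &, injective g} -> enumerates (g @: A) (g \o f).
Proof.
case=> fi fA gi; split; last by rewrite imset_comp fA.
have fP u : f u \in A by rewrite -fA imset_f.
by move=> u v e; apply/fi/gi.
Qed.

Lemma enumerates_split A1 A2 p1 p2 (f1 : 'I_p1 -> I) (f2 : 'I_p2 -> I) :
    enumerates A1 f1 -> enumerates A2 f2 -> [disjoint A1 & A2] ->
  enumerates (A1 :|: A2) (split_case f1 f2).
Proof.
case=> i1 e1 [i2 e2] /pred0P dis.
have P1 u : f1 u \in A1 by rewrite -e1 imset_f.
have P2 u : f2 u \in A2 by rewrite -e2 imset_f.
have n12 u v : f1 u <> f2 v.
  by move=> e; have /= := dis (f1 u); rewrite P1 e P2.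
have E1 u : split_case f1 f2 (lshift p2 u) = f1 u.
  by rewrite /split_case; case: split_ordP => v /eqP; rewrite ?eq_shift // => /eqP ->.
have E2 u : split_case f1 f2 (rshift p1 u) = f2 u.
  by rewrite /split_case; case: split_ordP => v /eqP; rewrite ?eq_shift // => /eqP ->.
split.
  move=> u v; case: (split_ordP u) => u' ->; case: (split_ordP v) => v' ->;
    rewrite ?E1 ?E2; first by move/i1 ->.
  - by move/n12.
  - by move/esym/n12.
  - by move/i2 ->.
apply/setP => x; rewrite inE -e1 -e2; apply/imsetP/orP.
  move=> [u _ ->]; case: (split_ordP u) => v ->; rewrite ?E1 ?E2.
    by left; rewrite imset_f.
  by right; rewrite imset_f.
case=> /imsetP[u _ ->].
  by exists (lshift p2 u); rewrite ?inE ?E1.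
by exists (rshift p1 u); rewrite ?inE ?E2.
Qed.

End Enumerates.

(** * Determinants indexed by finite sets *)

Section SetDet.

Variables (R : comNzRingType) (I J : finType).
Implicit Types (A : {set I}) (C : {set J}) (F : I -> J -> R).

Definition set_mx A C F : 'M[R]_(#|A|, #|C|) :=
  \matrix_(u, v) F (enum_val u) (enum_val v).

(** With labels in finite sets, splitting the sets gives blocks and relabelling is taking images; up
    to sign the numbering does not matter. *)
Definition sdet A C F : R := sqdet (set_mx A C F).

Lemma sqdet_enumerates p q (M : 'M[R]_(p, q)) A C F (f : 'I_p -> I) (g : 'I_q -> J) :
    enumerates A f -> enumerates C g -> (forall u v, M u v = F (f u) (g v)) ->
  sqdet M =± sdet A C F.
Proof.
move=> fA gC MF.
have fP u : f u \in A by case: fA => _ <-; rewrite imset_f.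
have gP u : g u \in C by case: gC => _ <-; rewrite imset_f.
apply: (@sqdet_perm _ _ _ _ _ _ _
  (fun u => enum_rank_in (fP u) (f u)) (fun v => enum_rank_in (gP v) (g v))).
- apply: inj_card_bij; last by rewrite !card_ord (enumerates_card fA).
  move=> u v /(congr1 enum_val); rewrite !enum_rankK_in //.
  by case: fA => fi _ /fi.
- apply: inj_card_bij; last by rewrite !card_ord (enumerates_card gC).
  move=> u v /(congr1 enum_val); rewrite !enum_rankK_in //.
  by case: gC => gi _ /gi.
- by move=> u v; rewrite !mxE !enum_rankK_in.
Qed.

Lemma sqdet_set_mx p q (M : 'M[R]_(p, q)) A C F (f : 'I_p -> I) (g : 'I_q -> J) :
    enumerates A f -> enumerates C g -> (forall u v, M u v = F (f u) (g v)) ->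
  sdet A C F =± sqdet M.
Proof. by move=> fA gC MF; apply/eq_sign_sym/(sqdet_enumerates fA gC). Qed.

Lemma eq_sdet A C F G :
  {in A & C, forall i j, F i j = G i j} -> sdet A C F = sdet A C G.
Proof.
move=> FG; congr sqdet; apply/matrixP => u v; rewrite !mxE.
by apply: FG; apply: enum_valP.
Qed.

(** Numbering [A1] before [A2] and [C1] before [C2] gives an upper block triangular matrix. *)
Lemma sdet_block A1 A2 C1 C2 F :
    [disjoint A1 & A2] -> [disjoint C1 & C2] -> #|A1| = #|C1| -> #|A2| = #|C2| ->
    {in A2 & C1, forall i j, F i j = 0} ->
  sdet (A1 :|: A2) (C1 :|: C2) F =± sdet A1 C1 F * sdet A2 C2 F.
Proof.
move=> dA dC c1 c2 F0; rewrite -(@sqdet_ublock _ _ _ _ _ _ (set_mx A1 C2 F)) //.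
apply: sqdet_set_mx.
- apply: enumerates_split dA; exact: enumerates_enum_val.
- apply: enumerates_split dC; exact: enumerates_enum_val.
- move=> u v; rewrite /split_case !mxE; case: splitP => u' _;
    rewrite !mxE; case: splitP => v' _; rewrite !mxE //.
  by rewrite F0 //; apply: enum_valP.
Qed.

End SetDet.

Lemma sdet_imset (R : comNzRingType) (I J I' J' : finType) (A : {set I})
    (C : {set J}) (f : I -> I') (g : J -> J') (F : I' -> J' -> R) :
    {in A &, injective f} -> {in C &, injective g} ->
  sdet (f @: A) (g @: C) F =± sdet A C (fun i j => F (f i) (g j)).
Proof.
move=> fi gi; apply: sqdet_set_mx.
- by apply: enumerates_comp fi; apply: enumerates_enum_val.
- by apply: enumerates_comp gi; apply: enumerates_enum_val.
- by move=> u v; rewrite mxE.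
Qed.

Lemma sdet_imset_rows (R : comNzRingType) (I I' J : finType) (A : {set I})
    (C : {set J}) (f : I -> I') (F : I' -> J -> R) :
    {in A &, injective f} ->
  sdet (f @: A) C F =± sdet A C (fun i j => F (f i) j).
Proof. by move=> fi; rewrite -{1}[C](imset_id); apply: sdet_imset. Qed.

Lemma sdet_imset_cols (R : comNzRingType) (I J J' : finType) (A : {set I})
    (C : {set J}) (g : J -> J') (F : I -> J' -> R) :
    {in C &, injective g} ->
  sdet A (g @: C) F =± sdet A C (fun i j => F i (g j)).
Proof. by move=> gi; rewrite -{1}[A](imset_id); apply: sdet_imset. Qed.

Lemma sdet_id (R : comNzRingType) (I : finType) (A : {set I}) :
  sdet A A (fun i j => (i == j)%:R : R) = 1.
Proof.
rewrite /sdet sqdetE -[RHS](@det1 _ #|A|); congr (\det _).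
by apply/matrixP => u v; rewrite !mxE (inj_eq enum_val_inj).
Qed.

Lemma sdet_mul (R : comNzRingType) (I J K : finType) (A : {set I})
    (B : {set J}) (C : {set K}) (F : I -> J -> R) (G : J -> K -> R) :
    #|A| = #|B| -> #|B| = #|C| ->
  sdet A B F * sdet B C G = sdet A C (fun i k => \sum_(j in B) F i j * G j k).
Proof.
move=> AB BC; rewrite /sdet -sqdet_mul //; congr sqdet.
apply/matrixP => u v; rewrite !mxE [RHS]big_enum_val /=.
by apply: eq_bigr => w _; rewrite !mxE.
Qed.

Lemma sdet_map (R R' : comNzRingType) (f : {rmorphism R -> R'}) (I J : finType)
    (A : {set I}) (C : {set J}) (F : I -> J -> R) :
  f (sdet A C F) = sdet A C (fun i j => f (F i j)).
Proof.
by rewrite -sqdet_map; congr sqdet; apply/matrixP => u v; rewrite !mxE.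
Qed.

Lemma card_graded (I : finType) (A : {set I}) (dA : I -> nat) (b : nat) :
    {in A, forall i, dA i < b}%N ->
  #|A| = (\sum_(0 <= e < b) #|[set i in A | dA i == e]|)%N.
Proof.
move=> Ab; rewrite -sum1_card.
transitivity (\sum_(i in A) \sum_(0 <= e < b | e == dA i) 1)%N.
  by apply: eq_bigr => i iA; rewrite big_nat1_eq /= Ab.
rewrite (exchange_big_dep predT) //=; apply: eq_bigr => e _.
by rewrite -sum1dep_card; apply: eq_bigl => i; rewrite eq_sym.
Qed.

(** Induction on the degree bound: rows of degree below [b] vanish in the columns of degree [b], so
    the part of degree [b] splits off as a diagonal block. *)
Lemma sdet_graded (R : comNzRingType) (I J : finType) (A : {set I})
    (C : {set J}) (dA : I -> nat) (dC : J -> nat) (b : nat) (F : I -> J -> R) :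
    {in A, forall i, dA i < b}%N -> {in C, forall j, dC j < b}%N ->
    (forall e, (e < b)%N ->
      #|[set i in A | dA i == e]| = #|[set j in C | dC j == e]|) ->
    {in A & C, forall i j, (dA i < dC j)%N -> F i j = 0} ->
  sdet A C F =±
    \prod_(0 <= e < b) sdet [set i in A | dA i == e] [set j in C | dC j == e] F.
Proof.
elim: b A C => [|b IHb] A C Ab Cb cardAC F0.
  have -> : A = set0.
    by apply/setP => i; rewrite inE; apply/negP => /Ab.
  have -> : C = set0.
    by apply/setP => i; rewrite inE; apply/negP => /Cb.
  (* Both sides have size 0 once 1 is written as the determinant over the empty set. *)
  rewrite big_geq // -(sdet_id R (set0 : {set I})).
  apply: (@sqdet_perm _ _ _ _ _ _ _
     (cast_ord (esym (etrans (cards0 I) (esym (cards0 I)))))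
     (cast_ord (etrans (cards0 J) (esym (cards0 I))))).
  - by eexists; [apply: cast_ordK|apply: cast_ordKV].
  - by eexists; [apply: cast_ordK|apply: cast_ordKV].
  - by move=> u; have := enum_valP u; rewrite inE.
pose A1 := [set i in A | dA i == b]; pose A2 := [set i in A | (dA i < b)%N].
pose C1 := [set i in C | dC i == b]; pose C2 := [set i in C | (dC i < b)%N].
have eA : A = A1 :|: A2.
  apply/setP => i; rewrite !inE -andb_orr -leq_eqVlt -ltnS.
  by case: (boolP (i \in A)) => // /Ab ->.
have eC : C = C1 :|: C2.
  apply/setP => i; rewrite !inE -andb_orr -leq_eqVlt -ltnS.
  by case: (boolP (i \in C)) => // /Cb ->.
have lA e : (e < b)%N -> [set i in A2 | dA i == e] = [set i in A | dA i == e].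
  move=> eb; apply/setP => i; rewrite !inE -andbA; congr (_ && _).
  by apply/andP/idP => [[]//|/[dup] /eqP -> ->].
have lC e : (e < b)%N -> [set i in C2 | dC i == e] = [set i in C | dC i == e].
  move=> eb; apply/setP => i; rewrite !inE -andbA; congr (_ && _).
  by apply/andP/idP => [[]//|/[dup] /eqP -> ->].
rewrite big_nat_recr //= mulrC.
apply: (@eq_sign_trans _ (sdet A1 C1 F * sdet A2 C2 F)).
  rewrite {1}eA {1}eC; apply: sdet_block.
  - rewrite -setI_eq0; apply/eqP/setP => i; rewrite !inE.
    by case: ltngtP; rewrite ?andbF.
  - rewrite -setI_eq0; apply/eqP/setP => i; rewrite !inE.
    by case: ltngtP; rewrite ?andbF.
  - exact: cardAC.
  - rewrite (@card_graded _ A2 dA b) => [|i]; last by rewrite inE => /andP[].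
    rewrite (@card_graded _ C2 dC b) => [|i]; last by rewrite inE => /andP[].
    by apply: eq_big_nat => e /andP[_ eb]; rewrite lA // lC // cardAC // ltnW.
  - move=> i j; rewrite !inE => /andP[iA ib] /andP[jC /eqP jb].
    by apply: F0; rewrite ?jb.
apply: eq_signM; first exact: eq_sign_refl.
rewrite [X in _ =± X](eq_big_nat _ _ (F2 := fun e =>
   sdet [set i in A2 | dA i == e] [set j in C2 | dC j == e] F)); last first.
  by move=> e /andP[_ eb]; rewrite lA // lC.
apply: IHb.
- by move=> i; rewrite inE => /andP[].
- by move=> i; rewrite inE => /andP[].
- by move=> e eb; rewrite lA // lC // cardAC // ltnW.
- by move=> i j; rewrite !inE => /andP[iA _] /andP[jC _]; apply: F0.
Qed.

(** * Monomials and row labels *)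

(** By symmetry one inequality is enough. The lemma lets [tau] and [hilb_all], whose types carry
    bounds of their own, be counted among the monomials of degree at most [tstar]. *)
Lemma card_bmultinom (n b b' : nat) (P : pred 'X_{1..n}) :
    (forall m, P m -> mdeg m < b)%N -> (forall m, P m -> mdeg m < b')%N ->
  #|[set m : 'X_{1..n < b} | P m]| = #|[set m : 'X_{1..n < b'} | P m]|.
Proof.
have le c c' : (forall m, P m -> mdeg m < c')%N ->
    (#|[set m : 'X_{1..n < c} | P m]| <= #|[set m : 'X_{1..n < c'} | P m]|)%N.
  move=> Pc'.
  (* Both types are mapped to a common one. Its bound is a successor, so that [bm0] exists as a
     default; [f] does not take the default where [P] holds. *)
  pose f (m : 'X_{1..n < c}) : 'X_{1..n < c'.+1} := insubd bm0 m.
  pose g (m : 'X_{1..n < c'}) : 'X_{1..n < c'.+1} := insubd bm0 m.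
  have gE (m : 'X_{1..n < c'}) : g m = m :> 'X_{1..n}.
    by rewrite val_insubd ltnW ?ltnS // bmdeg.
  have fE (m : 'X_{1..n < c}) : P m -> f m = m :> 'X_{1..n}.
    by move=> /Pc' mc'; rewrite val_insubd ltnW.
  have gi : injective g by move=> m m' e; apply: val_inj; rewrite /= -!gE e.
  rewrite -(card_imset _ gi) -(@card_in_imset _ _ f) => [|m m']; last first.
    by rewrite !inE => Pm Pm' e; apply: val_inj; rewrite /= -(fE m Pm) -(fE m' Pm') e.
  apply/subset_leq_card/subsetP => _ /imsetP[m Pm ->]; rewrite inE in Pm.
  apply/imsetP; exists (BMultinom (Pc' _ Pm)); first by rewrite inE; exact: Pm.
  by apply: val_inj; rewrite [LHS](fE m Pm) [RHS]gE.
by move=> Pb Pb'; apply/eqP; rewrite eqn_leq !le.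
Qed.

Section Monomials.

Variables (n : nat) (d : 'I_n.+1 -> nat).
Hypothesis d_gt0 : forall i, (0 < d i)%N.

Lemma leq_mdeg (m : 'X_{1..n}) j : (m j <= mdeg m)%N.
Proof. by rewrite mdegE (bigD1 j) //= leq_addr. Qed.

Lemma reduced_mdeg m : reduced d m -> (mdeg m <= rho d)%N.
Proof.
move=> /forallP red; rewrite mdegE; apply: leq_sum => j _.
by have := red j; lia.
Qed.

Variable t : nat.
Local Notation mon := 'X_{1..n < (tstar d t).+1}.

Lemma reduced_bound m : reduced d m -> (mdeg m < (tstar d t).+1)%N.
Proof. by move/reduced_mdeg; rewrite /tstar; lia. Qed.

(** The exponent vectors of the reduced monomials fill a box with sides d_j, here [family G]. *)
Lemma card_reduced : #|[set m : mon | reduced d m]| = bezout d.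
Proof.
pose g (m : mon) : {ffun 'I_n -> 'I_(tstar d t).+1} := [ffun j => inord (m j)].
have gE (m : mon) j : g m j = m j :> nat.
  by rewrite ffunE inordK // (leq_ltn_trans (leq_mdeg m j)) ?bmdeg.
have gi : injective g.
  by move=> m m' /ffunP e; apply/val_inj/mnmP => j /=; rewrite -!gE e.
rewrite -(card_imset _ gi).
pose G (j : 'I_n) := [pred x : 'I_(tstar d t).+1 | (x < d (ix j))%N].
have -> : #|g @: [set m : mon | reduced d m]| = #|family G|.
  apply: eq_card => f; apply/imsetP/familyP => [[m mred ->] j|fG].
    by move: mred; rewrite inE => /forallP /(_ j); rewrite -gE.
  pose m0 := [multinom (f j : nat) | j < n].
  have m0red : reduced d m0 by apply/forallP => j; rewrite mnmE; apply: fG.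
  exists (BMultinom (reduced_bound m0red)); first by rewrite inE.
  by apply/ffunP => j; apply: val_inj; rewrite [RHS]gE mnmE.
rewrite card_family foldrE big_map big_enum /=; apply: eq_bigr => j _.
rewrite -[RHS]card_ord.
(* As d_j - 1 <= [rho] <= [tstar], the ordinal type holds all d_j values of the j-th exponent. *)
have dle : (d (ix j) <= (tstar d t).+1)%N.
  have : ((d (ix j)).-1 <= rho d)%N by rewrite /rho (bigD1 j) //= leq_addr.
  by rewrite /tstar; have := d_gt0 (ix j); lia.
have wi : injective (widen_ord dle) by move=> x y /(congr1 val) /= /val_inj.
rewrite -(card_imset predT wi); apply: eq_card => x.
apply/idP/imsetP => [xd|[y _ ->]]; last exact: (ltn_ord y).
by exists (Ordinal (xd : (x < d (ix j))%N)) => //; apply: val_inj.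
Qed.

(* The leading monomial of x^a f_i when f_i is specialized to x_i^{d_i}; this map
   matches the row labels of degree j with the non-reduced monomials. *)
Definition lead (p : 'I_n * mon) : mon :=
  insubd bm0 (p.2 + U_(p.1) *+ d (ix p.1))%MM.

Lemma leadE (p : 'I_n * mon) : (mdeg p.2 + d (ix p.1) <= tstar d t)%N ->
  lead p = (p.2 + U_(p.1) *+ d (ix p.1))%MM :> 'X_{1..n}.
Proof.
by move=> le; rewrite val_insubd mdegD mdegMn mdeg1 mul1n ltnS le.
Qed.

Definition nonreduced (j : nat) : {set mon} :=
  [set m : mon | mdeg m == j & ~~ reduced d m].

Section Degree.

Variable j : nat.
Hypothesis le_j : (j <= tstar d t)%N.

Lemma lead_rowsE p l : p \in rows_top d t j ->
  lead p l = (p.2 l + (p.1 == l) * d (ix p.1))%N.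
Proof.
rewrite inE => /andP[/eqP jE _].
by rewrite leadE ?jE // mnmDE mulmnE mnm1E.
Qed.

(** If labels with i < i' had the same image, its exponent at i would be at least d_i by the first
    label and less than d_i by the second, which is reduced in the variables before i'. *)
Lemma lead_inj : {in rows_top d t j &, injective lead}.
Proof.
have lt i a i' a' : (i, a) \in rows_top d t j -> (i', a') \in rows_top d t j ->
    lead (i, a) = lead (i', a') -> (i < i')%N -> False.
  move=> /[dup] r + /[dup] r' + e ii'; rewrite !inE => _ /andP[_ /forallP /(_ i)].
  have := congr1 (fun m : mon => m i) e; rewrite !lead_rowsE //= eqxx ii' /=.
  by have -> : (i' == i) = false by [apply/eqP => ei; move: ii'; rewrite ei ltnn]; lia.
move=> [i a] [i' a'] r r' e.
have ei : i = i'.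
  by apply/val_inj => /=; case: (ltngtP i i') => //
    [/(lt _ _ _ _ r r' e)|/(lt _ _ _ _ r' r (esym e))].
move: r' e; rewrite -ei => r' e; congr (_, _); apply/val_inj/mnmP => l /=.
have := congr1 (fun m : mon => m l) e; rewrite !lead_rowsE //=; lia.
Qed.

(** For surjectivity, divide a non-reduced monomial by x_i^{d_i} for the least i with exponent at
    least d_i; minimality makes the quotient a row label of i. *)
Lemma lead_rows_top : lead @: rows_top d t j = nonreduced j.
Proof.
apply/setP => m; apply/imsetP/idP => [[p pr ->]|].
  have pE := lead_rowsE _ pr; move: pr; rewrite !inE => /andP[/eqP jE _].
  rewrite leadE ?jE // mdegD mdegMn mdeg1 mul1n jE eqxx /= negb_forall.
  by apply/existsP; exists p.1; rewrite -leqNgt mnmDE mulmnE mnm1E eqxx mul1n leq_addl.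
rewrite inE negb_forall => /andP[/eqP mj /existsP[i0]]; rewrite -leqNgt => i0P.
case: (@arg_minnP _ i0 (fun i => d (ix i) <= m i)%N (@nat_of_ord n) i0P) => i iP imin.
have le : (U_(i) *+ d (ix i) <= m)%MM.
  apply/mnm_lepP => l; rewrite mulmnE mnm1E.
  by case: eqVneq => [<-|_]; rewrite ?mul1n ?mul0n.
pose a := (m - U_(i) *+ d (ix i))%MM.
have aE : (a + U_(i) *+ d (ix i))%MM = m by rewrite submK.
have adeg : (mdeg a + d (ix i))%N = j.
  by rewrite -mj -aE mdegD mdegMn mdeg1 mul1n.
have ab : (mdeg a < (tstar d t).+1)%N.
  by rewrite ltnS (leq_trans _ le_j) // -adeg leq_addr.
have pr : (i, BMultinom ab) \in rows_top d t j.
  rewrite inE /= adeg eqxx /=; apply/forallP => l; apply/implyP.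
  apply: contraTltn => dl; rewrite -leqNgt; apply: imin.
  by rewrite -aE mnmDE (leq_trans dl) ?leq_addr.
by exists (i, BMultinom ab) => //; apply: val_inj; rewrite [RHS]leadE /= ?aE ?adeg.
Qed.

(** The image of (i, x^a) has a large exponent at i, and its exponents before i are small; so a
    second large exponent can only occur at some l > i. *)
Lemma lead_rows_Etop : lead @: rows_Etop d t j = cols_Etop d t j.
Proof.
apply/setP => m; apply/imsetP/idP => [[p pr ->]|].
  move: (pr); rewrite inE => /andP[pr' /existsP[l /andP[pl dl]]].
  have : lead p \in nonreduced j by rewrite -lead_rows_top imset_f.
  rewrite !inE => /andP[-> _] /=; apply/existsP; exists p.1; apply/existsP; exists l.
  rewrite !lead_rowsE // eqxx.
  by rewrite (leq_trans dl (leq_addr _ _)); have := pl; case: eqP => [->|]; lia.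
rewrite inE => /andP[mj /existsP[i /existsP[l /and3P[il di dl]]]].
have : m \in nonreduced j.
  rewrite inE mj negb_forall; apply/existsP; exists i; rewrite -leqNgt; lia.
rewrite -lead_rows_top => /imsetP[p pr mE]; exists p => //.
move: (pr); rewrite !inE => /andP[pj pl]; rewrite pj pl /=.
have {pl} /forallP pl := pl.
have big (k : 'I_n) : p.1 != k -> (d (ix k) <= m k)%N ->
   [exists l : 'I_n, (p.1 < l)%N && (d (ix l) <= p.2 l)%N].
  move=> pk; rewrite mE lead_rowsE // (negbTE pk) mul0n addn0 => dk.
  apply/existsP; exists k; apply/andP; split=> //; rewrite ltn_neqAle pk leqNgt /=.
  by apply/negP => kp; have := implyP (pl k) kp; rewrite ltnNge => /negP; apply.
have [pi|pi] := eqVneq p.1 i; last exact: big di.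
by apply: big dl; rewrite pi.
Qed.

Lemma card_rows_top : #|rows_top d t j| = #|nonreduced j|.
Proof. by rewrite -lead_rows_top card_in_imset //; apply: lead_inj. Qed.

Lemma card_rows_Etop : #|rows_Etop d t j| = #|cols_Etop d t j|.
Proof.
rewrite -lead_rows_Etop card_in_imset // => p q.
by rewrite !inE => /andP[pj _] /andP[qj _]; apply: lead_inj; rewrite inE.
Qed.

End Degree.

End Monomials.

(** * Generic coefficients *)

Section Coefficients.

Variable n : nat.

Lemma mcoeffXM (R : nzRingType) (a m : 'X_{1..n}) (p : {mpoly R[n]}) :
  ('X_[a] * p)@_m = if (a <= m)%MM then p@_(m - a) else 0.
Proof.
case: ifP => [am|/negP am]; rewrite -commr_mpolyX.
  by rewrite -{1}(submK am) addmC mcoeffMX.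
apply: memN_msupp_eq0; rewrite (perm_mem (msuppMX p a)).
by apply/mapP => -[m' _ mE]; apply: am; rewrite mE lem_addr.
Qed.

Lemma mcoeff_map_XM (R R' : nzRingType) (f : {rmorphism R -> R'}) (a m : 'X_{1..n})
    (p : {mpoly R[n]}) : f ('X_[a] * p)@_m = ('X_[a] * map_mpoly f p)@_m.
Proof. by rewrite !mcoeffXM; case: ifP; rewrite ?rmorph0 // mcoeff_map_mpoly. Qed.

Lemma mcoeff_pihomog (R : nzRingType) e (p : {mpoly R[n]}) m :
  (pihomog mdeg e p)@_m = if mdeg m == e then p@_m else 0.
Proof.
rewrite pihomogE (big_morph _ (mcoeffD m) (mcoeff0 _ m)) big_mkcond /=.
case: eqP => me; last first.
  apply: big1 => m' _; case: eqP => // m'e.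
  by rewrite mcoeffZ mcoeffX; case: eqP => [mm|]; rewrite ?mulr0 // -mm in me *.
rewrite [in RHS](mpolyE p) (big_morph _ (mcoeffD m) (mcoeff0 _ m)).
apply: eq_bigr => m' _; rewrite mcoeffZ mcoeffX.
by case: (m' =P m) => [->|]; rewrite ?me ?eqxx // mulr0 if_same.
Qed.

Lemma mcoeff_sum_bounded (R : nzRingType) b (c : 'X_{1..n < b} -> R) (m : 'X_{1..n}) :
  (b <= mdeg m)%N -> (\sum_(m' : 'X_{1..n < b}) c m' *: 'X_[m'])@_m = 0.
Proof.
move=> bm; rewrite (big_morph _ (mcoeffD m) (mcoeff0 _ m)) big1 // => m' _.
rewrite mcoeffZ mcoeffX; case: eqP => [mm|]; rewrite ?mulr0 //.
by move: bm; rewrite -mm leqNgt bmdeg.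
Qed.

End Coefficients.

(** * The generic polynomials and their specialization *)

Section GenericPolynomials.

Variables (n : nat) (d : 'I_n.+1 -> nat).

Lemma mcoeff_gen_poly i m : (d i < mdeg m)%N -> (gen_poly d i)@_m = 0.
Proof. exact: mcoeff_sum_bounded. Qed.

Lemma mcoeffX_gen_poly i (a m : 'X_{1..n}) :
  (mdeg a + d i < mdeg m)%N -> ('X_[a] * gen_poly d i)@_m = 0.
Proof.
move=> lt; rewrite mcoeffXM; case: ifP => // am.
by apply: mcoeff_gen_poly; move: lt; rewrite -{1}(submK am) mdegD addnC ltn_add2r.
Qed.

(** In degree |a| + d_i only the top component of f_i contributes. Hence the diagonal blocks of the
    graded matrices are matrices of top forms. *)
Lemma mcoeffX_gen_top i (a m : 'X_{1..n}) : mdeg m = (mdeg a + d (ix i))%N ->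
  ('X_[a] * gen_top d i)@_m = ('X_[a] * gen_poly d (ix i))@_m.
Proof.
move=> em; rewrite !mcoeffXM; case: ifP => // am.
rewrite mcoeff_pihomog ifT //; move: em; rewrite -{1}(submK am) mdegD; lia.
Qed.

Let coef_ring := {mpoly rat[#|{: coef_index d}|]}.

(** The generic polynomial before passing to fractions: specializing the coefficients is a ring
    morphism on polynomials, not on their fraction field. *)
Definition int_poly (i : 'I_n.+1) : {mpoly coef_ring[n]} :=
  \sum_(m : 'X_{1..n < (d i).+1})
     'X_(enum_rank (Tagged (fun i => 'X_{1..n < (d i).+1}) m : coef_index d)) *: 'X_[m].

Lemma map_int_poly i : map_mpoly (@tofrac _) (int_poly i) = gen_poly d i.
Proof.
rewrite raddf_sum; apply: eq_bigr => m _ /=.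
by rewrite map_mpolyZ map_mpolyX.
Qed.

(* The specialization f_j -> x_j ^ d_j of the coefficients. *)
Definition spec (k : 'I_#|{: coef_index d}|) : rat :=
  [exists j : 'I_n, (ix j == tag (enum_val k)) &&
     ((U_(j) *+ d (ix j))%MM == tagged (enum_val k) :> 'X_{1..n})]%:R.

Lemma ix_inj : injective (@ix n).
Proof. by move=> i j /(congr1 val) /= /val_inj. Qed.

Lemma map_spec i : map_mpoly (meval spec) (int_poly (ix i)) = 'X_[U_(i) *+ d (ix i)].
Proof.
rewrite raddf_sum /=.
have b : (mdeg (U_(i) *+ d (ix i)) < (d (ix i)).+1)%N by rewrite mdegMn mdeg1 mul1n.
rewrite (bigD1 (BMultinom b)) //= big1 => [|m mN].
  rewrite addr0 map_mpolyZ map_mpolyX /= mevalXU /spec enum_rankK /=.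
  have -> : [exists j : 'I_n, (ix j == ix i) &&
      ((U_(j) *+ d (ix j))%MM == (U_(i) *+ d (ix i))%MM)].
    by apply/existsP; exists i; rewrite !eqxx.
  by rewrite scale1r.
rewrite map_mpolyZ map_mpolyX /= mevalXU /spec enum_rankK /=.
case: existsP => [[j /andP[/eqP /ix_inj -> /eqP e]]|]; last by rewrite scale0r.
by case/eqP: mN; apply: val_inj.
Qed.

Variable t : nat.
Local Notation mon := 'X_{1..n < (tstar d t).+1}.

Lemma sdet_rows_top_neq0 j : (j <= tstar d t)%N ->
  sdet (rows_top d t j) (nonreduced d t j)
    (fun p (m : mon) => ('X_[p.2] * gen_poly d (ix p.1))@_m) != 0.
Proof.
move=> jt; set A := rows_top d t j; set C := nonreduced d t j.
pose F (p : 'I_n * mon) (m : mon) := ('X_[p.2] * int_poly (ix p.1))@_m.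
rewrite (@eq_sdet _ _ _ _ _ _ (fun p m => tofrac (F p m))) => [|p m _ _]; last first.
  by rewrite mcoeff_map_XM map_int_poly.
(* Since [tofrac] is injective, a zero determinant would already vanish over the coefficient ring,
   and so after specialization. *)
rewrite -sdet_map tofrac_eq0; apply: contraTneq isT => F0.
have : meval spec (sdet A C F) = 0 by rewrite F0 meval0.
(* Row [p] has become the single monomial [lead p]; relabelling the rows by [lead] gives an identity
   matrix. *)
rewrite sdet_map (@eq_sdet _ _ _ _ _ _ (fun p m => (lead p == m)%:R)) => [|p m pA _].
  rewrite -[C](lead_rows_top jt).
  have := sdet_imset_rows (@lead n d t @: A)
    (fun m m' : mon => (m == m')%:R : rat) (lead_inj jt).
  by rewrite sdet_id => -[e E1] E2; move/eqP: E1; rewrite [X in _ * X]E2 mulr0 oner_eq0.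
rewrite mcoeff_map_XM map_spec -mpolyXD mcoeffX bmeqP leadE //.
by move: pA; rewrite inE => /andP[/eqP -> _].
Qed.

End GenericPolynomials.

(** * Cardinalities *)

Section Counting.

Variables (n : nat) (d : 'I_n.+1 -> nat).
Hypothesis d_gt0 : forall i, (0 < d i)%N.
Variable t : nat.
Local Notation mon := 'X_{1..n < (tstar d t).+1}.
Variable T : nat -> {set mon}.
Hypothesis admT : admissible T.

Lemma admissible_mdeg j m : m \in T j -> mdeg m = j.
Proof. by case: (admT j) => H _ _; apply: H. Qed.

Lemma mem_Tall m : (m \in Tall T) = (m \in T (mdeg m)).
Proof.
rewrite /Tall big_mkord; apply/bigcupP/idP => [[j _ mT]|mT].
  by rewrite (admissible_mdeg mT).
by exists (Ordinal (bmdeg m)).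
Qed.

Lemma mem_Tstar m : (m \in Tstar T) = (t < mdeg m)%N && (m \in T (mdeg m)).
Proof.
rewrite /Tstar big_geq_mkord; apply/bigcupP/andP => [[j jt mT]|[mt mT]].
  by rewrite (admissible_mdeg mT).
by exists (Ordinal (bmdeg m)).
Qed.

Lemma tau_mon j : tau d j = #|[set m : mon | (mdeg m == j) && reduced d m]|.
Proof.
apply: (@card_bmultinom _ _ _ (fun m : 'X_{1..n} => (mdeg m == j) && reduced d m)).
  by move=> m /andP[/eqP ->].
by move=> m /andP[_ /reduced_bound].
Qed.

Lemma card_by_degree (A B : {set mon}) :
    (forall j, #|[set m in A | mdeg m == j]| = #|[set m in B | mdeg m == j]|) ->
  #|A| = #|B|.
Proof.
move=> AB; pose dg (m : mon) := mdeg m.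
have bd (C : {set mon}) : {in C, forall m, dg m < (tstar d t).+1}%N.
  by move=> m _; apply: bmdeg.
rewrite (card_graded (bd A)) (card_graded (bd B)).
by apply: eq_bigr => j _; apply: AB.
Qed.

(** In each degree, [T j] has as many elements as there are reduced monomials; [P] keeps or drops
    whole degrees. *)
Lemma card_restricted (P : pred nat) :
  #|[set m : mon | P (mdeg m) & m \in T (mdeg m)]| =
  #|[set m : mon | P (mdeg m) & reduced d m]|.
Proof.
apply: card_by_degree => j; case: (boolP (P j)) => Pj; last first.
  transitivity 0%N; [|apply/esym]; apply/eqP; rewrite cards_eq0; apply/eqP/setP => m;
    by rewrite !inE; case: eqP => [->|]; rewrite ?(negbTE Pj) ?andbF.
have [_ cT _] := admT j; rewrite -[RHS](_ : tau d j = _).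
  rewrite -cT; apply: eq_card => m; rewrite !inE.
  apply/andP/idP => [[/andP[_ mT] /eqP <-] //|mT].
  by rewrite (admissible_mdeg mT) Pj mT eqxx.
rewrite tau_mon; apply: eq_card => m; rewrite !inE andbC.
by case: eqP => [->|]; rewrite ?Pj ?andbF.
Qed.

Lemma card_Tall : #|Tall T| = bezout d.
Proof.
rewrite -(card_reduced d_gt0 t).
transitivity #|[set m : mon | predT (mdeg m) & m \in T (mdeg m)]|.
  by apply: eq_card => m; rewrite mem_Tall inE.
by rewrite card_restricted; apply: eq_card => m; rewrite !inE.
Qed.

Lemma card_Tstar : #|Tstar T| = #|[set m : mon | (t < mdeg m)%N & reduced d m]|.
Proof.
rewrite -(card_restricted (fun e => t < e)%N).
by apply: eq_card => m; rewrite mem_Tstar inE.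
Qed.

Lemma hilb_all_mon : hilb_all d t =
  #|[set m : mon | [&& (mdeg m <= t)%N, reduced d m & (t - mdeg m < d ord_max)%N]]|.
Proof.
transitivity #|[set m : 'X_{1..n < t.+1} |
   [&& (mdeg m <= t)%N, reduced d m & (t - mdeg m < d ord_max)%N]]|.
  by apply: eq_card => m; rewrite !inE (_ : (mdeg m <= t)%N) // -ltnS bmdeg.
apply: (@card_bmultinom _ _ _ (fun m : 'X_{1..n} =>
   [&& (mdeg m <= t)%N, reduced d m & (t - mdeg m < d ord_max)%N])) => m /and3P[] //.
by move=> _ /reduced_bound.
Qed.

Lemma mem_Rset_max (m : mon) :
  (m \in @Rset n d t ord_max) = (mdeg m + d ord_max <= t)%N && reduced d m.
Proof.
rewrite inE; congr (_ && _); apply: eq_forallb => j.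
by rewrite ltn_ord.
Qed.

(** The reduced monomials fall into three classes: t - d_{n+1} < degree <= t, degree > t, and degree
    <= t - d_{n+1}. They count the three blocks of rows of O_S, which is therefore square. *)
Lemma card_O_rows : (hilb_all d t + (#|Tstar T| + #|@Rset n d t ord_max|))%N = bezout d.
Proof.
pose red := [set m : mon | reduced d m].
pose low := [set m : mon | (mdeg m <= t)%N].
pose near := [set m : mon | (t - mdeg m < d ord_max)%N].
rewrite -(card_reduced d_gt0 t) -/red -(cardsID low red) -(cardsID near (red :&: low)).
rewrite -addnA; congr addn.
  by rewrite hilb_all_mon; apply: eq_card => m; rewrite !inE andbCA andbA.
rewrite addnC card_Tstar; congr addn.
  by apply: eq_card => m; rewrite mem_Rset_max !inE;
    have := d_gt0 ord_max; case: (reduced d m); lia.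
by apply: eq_card => m; rewrite !inE ltnNge.
Qed.

(** Both sets are complements, among the monomials of degree [j], of sets with tau_j elements. *)
Lemma card_cols_top j : #|cols_top j (T j)| = #|nonreduced d t j|.
Proof.
pose deg := [set m : mon | mdeg m == j].
have [Tdeg cT _] := admT j.
apply/(@addnI #|T j|).
transitivity #|deg|.
  rewrite -(cardsID (T j) deg); congr addn; apply: eq_card => m; rewrite !inE 1?andbC //.
  by case: (boolP (m \in T j)) => //= /Tdeg ->; rewrite eqxx.
by rewrite cT tau_mon -(cardsID [set m : mon | reduced d m] deg); congr addn;
  apply: eq_card => m; rewrite !inE // andbC.
Qed.

Lemma cols_top_reduced j : (j + d ord_max <= t)%N -> cols_top j (T j) = nonreduced d t j.
Proof.
move=> jt; have [_ _ ->//] := admT j.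
by apply/setP => m; rewrite !inE; case: eqP.
Qed.

(* rows_init and cols_init index the matrix M' of the header. *)
Definition rows_init : {set 'I_n.+1 * mon} := [set p in rows_M d t | (p.1 < n)%N].

Definition cols_init : {set mon} := [set m : mon | (mdeg m <= t)%N & m \notin T (mdeg m)].

Definition row_deg (p : 'I_n.+1 * mon) : nat := (mdeg p.2 + d p.1)%N.

(** Carries the labels of the matrices of top forms to labels of M. *)
Definition widen_row (q : 'I_n * mon) : 'I_n.+1 * mon := (ix q.1, q.2).

Lemma widen_row_inj : injective widen_row.
Proof.
move=> [i a] [j b] e; congr pair; last exact: (congr1 snd e).
exact: ix_inj (congr1 fst e).
Qed.

Lemma widen_rowP (p : 'I_n.+1 * mon) : (p.1 < n)%N -> exists q, p = widen_row q.
Proof.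
by case: p => i a /= lt; exists (Ordinal lt, a); congr pair; apply: val_inj.
Qed.

Lemma mem_widen_row (A : {set 'I_n.+1 * mon}) (B : {set 'I_n * mon}) :
    (forall p, p \in A -> p.1 < n)%N ->
    (forall q, (widen_row q \in A) = (q \in B)) -> A = widen_row @: B.
Proof.
move=> An AB; apply/setP => p; apply/idP/imsetP => [pA|[q qB ->]]; last by rewrite AB.
by have [q pq] := widen_rowP (An _ pA); exists q; rewrite // -AB -pq.
Qed.

Lemma rows_init_level j : (j <= t)%N ->
  [set p in rows_init | row_deg p == j] = widen_row @: rows_top d t j.
Proof.
move=> jt; apply: mem_widen_row => [p|q]; first by rewrite !inE => /andP[/andP[]].
rewrite !inE /row_deg /= ltn_ord andbT.
by case: eqP => [e|]; rewrite ?andbF // e jt andbT.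
Qed.

(** For |a| + d_i = j the first alternative of [rows_E] reads j + d_{n+1} <= t, the same for all
    rows of degree j: it selects all of them, or leaves only the second alternative. *)
Lemma rows_E_level j : (j <= t)%N ->
  [set p in rows_E d t | row_deg p == j] =
  widen_row @: (if (j + d ord_max <= t)%N then rows_top d t j else rows_Etop d t j).
Proof.
move=> jt; apply: mem_widen_row => [p|q]; first by rewrite !inE => /andP[/andP[_ /andP[]]].
rewrite !inE /row_deg /= ltn_ord /=.
have [e|ne] := eqVneq (mdeg q.2 + d (ix q.1))%N j; last first.
  by rewrite andbF; case: ifP; rewrite !inE (negbTE ne).
rewrite andbT -subnDA addnC [(d (ix q.1) + _)%N]addnC e jt leq_subRL // addnC.
by case: ifP => _; rewrite !inE e eqxx ?andbT.
Qed.

Lemma cols_init_level j : (j <= t)%N ->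
  [set m in cols_init | mdeg m == j] = cols_top j (T j).
Proof.
move=> jt; apply/setP => m; rewrite !inE andbC.
by case: eqP => [->|]; rewrite ?jt.
Qed.

(** The cases match those of [rows_E_level]. In the first one, two large exponents are a special
    case of one large exponent, that is, of being non-reduced. *)
Lemma cols_E_level j : (j <= t)%N ->
  [set m in cols_E d t | mdeg m == j] =
  if (j + d ord_max <= t)%N then nonreduced d t j else cols_Etop d t j.
Proof.
move=> jt; apply/setP => m; rewrite !inE.
have [e|ne] := eqVneq (mdeg m) j; last first.
  by rewrite andbF; case: ifP; rewrite !inE (negbTE ne).
rewrite andbT e jt leq_subRL //; case: ifP => _; rewrite !inE e eqxx //=.
have -> : ~~ reduced d m = [exists i, (d (ix i) <= m i)%N].
  by rewrite negb_forall; apply: eq_existsb => i; rewrite -leqNgt.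
by apply/orb_idr => /existsP[i /existsP[l /and3P[_ di _]]]; apply/existsP; exists i.
Qed.

Lemma card_rows_init : #|rows_init| = #|cols_init|.
Proof.
rewrite (@card_graded _ _ row_deg t.+1) => [|p]; last first.
  by rewrite !inE => /andP[/andP[]].
rewrite (@card_graded _ cols_init (fun m : mon => mdeg m) t.+1) => [|m]; last first.
  by rewrite !inE => /andP[].
apply: eq_big_nat => j /andP[_]; rewrite ltnS => jt.
rewrite rows_init_level // cols_init_level // card_imset; last exact: widen_row_inj.
by rewrite card_cols_top card_rows_top // (leq_trans jt) // leq_maxr.
Qed.

End Counting.

(** * Grading by degree *)

Section Graded.

Variables (n : nat) (d : 'I_n.+1 -> nat) (t : nat).
Local Notation mon := 'X_{1..n < (tstar d t).+1}.
Variable T : nat -> {set mon}.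
Hypothesis admT : admissible T.

Definition gen_entry (p : 'I_n.+1 * mon) (m : mon) : genK d :=
  ('X_[p.2] * gen_poly d p.1)@_m.

Lemma gen_entry_eq0 p (m : mon) : (row_deg p < mdeg m)%N -> gen_entry p m = 0.
Proof. exact: mcoeffX_gen_poly. Qed.

Lemma sqdet_gen_mx (A : {set 'I_n.+1 * mon}) (C : {set mon}) :
  sqdet (coef_mx (gen_poly d) A C) = sdet A C gen_entry.
Proof. by congr sqdet; apply/matrixP => u v; rewrite !mxE. Qed.

Lemma sqdet_top_mx j (A : {set 'I_n * mon}) (C : {set mon}) :
    {subset A <= rows_top d t j} -> (forall m, m \in C -> mdeg m = j) ->
  sqdet (coef_mx (gen_top d) A C) = sdet A C (fun q => gen_entry (widen_row q)).
Proof.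
move=> Aj Cj; transitivity (sdet A C (fun q (m : mon) => ('X_[q.2] * gen_top d q.1)@_m)).
  by congr sqdet; apply/matrixP => u v; rewrite !mxE.
apply: eq_sdet => q m /Aj + /Cj mj; rewrite inE => /andP[/eqP e _].
by apply: mcoeffX_gen_top; rewrite mj.
Qed.

(** The determinant of M_j, written with the f_i in place of their top forms. *)
Definition top_det j : genK d :=
  sdet (rows_top d t j) (cols_top j (T j)) (fun q => gen_entry (widen_row q)).

Lemma Delta_topE j : Delta_top j (T j) = top_det j / extraneous_top d t j.
Proof.
by rewrite /Delta_top (@sqdet_top_mx j) // => m; rewrite inE => /andP[/eqP].
Qed.

Lemma extraneous_topE j : extraneous_top d t j =
  sdet (rows_Etop d t j) (cols_Etop d t j) (fun q => gen_entry (widen_row q)).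
Proof.
rewrite /extraneous_top (@sqdet_top_mx j) // => [q|m]; rewrite inE => /andP[] //.
by move/eqP.
Qed.

Lemma sdet_init :
  sdet (rows_init d t) (cols_init T) gen_entry =± \prod_(0 <= j < t.+1) top_det j.
Proof.
apply: eq_sign_trans.
  apply: (@sdet_graded _ _ _ _ _ (@row_deg n d t) (fun m : mon => mdeg m) t.+1).
  - by move=> p; rewrite !inE => /andP[/andP[]].
  - by move=> m; rewrite !inE => /andP[].
  - move=> j; rewrite ltnS => jt; rewrite rows_init_level // cols_init_level //.
    rewrite card_imset; last exact: widen_row_inj.
    by rewrite card_cols_top // card_rows_top // (leq_trans jt) // leq_maxr.
  - by move=> p m _ _; apply: gen_entry_eq0.
rewrite big_nat [X in _ =± X]big_nat; apply: eq_sign_prod => j /andP[_].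
rewrite ltnS => jt.
rewrite rows_init_level // cols_init_level //.
by apply: sdet_imset_rows => p q _ _; apply: widen_row_inj.
Qed.

(** For j <= t - d_{n+1} admissibility makes T_j the set of reduced monomials, so the block of E(t)
    is that of M'. *)
Lemma extraneous_graded : extraneous d t =±
  \prod_(0 <= j < t.+1)
     (if (j + d ord_max <= t)%N then top_det j else extraneous_top d t j).
Proof.
rewrite /extraneous sqdet_gen_mx.
apply: eq_sign_trans.
  apply: (@sdet_graded _ _ _ _ _ (@row_deg n d t) (fun m : mon => mdeg m) t.+1).
  - by move=> p; rewrite !inE => /andP[/andP[]].
  - by move=> m; rewrite !inE => /andP[].
  - move=> j; rewrite ltnS => jt; rewrite rows_E_level // cols_E_level //.
    rewrite card_imset; last exact: widen_row_inj.
    have jt' : (j <= tstar d t)%N by rewrite (leq_trans jt) // leq_maxr.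
    by case: ifP => _; rewrite ?card_rows_top ?card_rows_Etop.
  - by move=> p m _ _; apply: gen_entry_eq0.
rewrite big_nat [X in _ =± X]big_nat; apply: eq_sign_prod => j /andP[_].
rewrite ltnS => jt.
rewrite rows_E_level // cols_E_level //.
apply: eq_sign_trans; first by apply: sdet_imset_rows => p q _ _; apply: widen_row_inj.
apply: eq_signW; case: ifP => jd; last by rewrite extraneous_topE.
by rewrite /top_det cols_top_reduced.
Qed.

Lemma top_det_neq0 j : (j + d ord_max <= t)%N -> top_det j != 0.
Proof.
move=> jt; rewrite /top_det cols_top_reduced //.
apply: sdet_rows_top_neq0; rewrite leq_max; apply/orP; right.
by apply: leq_trans jt; rewrite leq_addr.
Qed.

Lemma sdet_init_div :
  sdet (rows_init d t) (cols_init T) gen_entry / extraneous d t =±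
    \prod_(t.+1 - d ord_max <= j < t.+1) Delta_top j (T j).
Proof.
apply: eq_sign_trans; first exact: eq_signM sdet_init (eq_signV extraneous_graded).
(* Inverting factor by factor is valid even at zero factors, as 0^-1 = 0; only the factors that
   cancel have to be nonzero. *)
apply: eq_signW; rewrite -prodfV -big_split /=.
(* An index j lies below the cut exactly if j + d_{n+1} <= t; truncation puts the cut at 0 when
   d_{n+1} > t. *)
rewrite (big_cat_nat (n := t.+1 - d ord_max)) //=; last exact: leq_subr.
rewrite [X in X * _]big_nat big1 ?mul1r => [|j /andP[_ jt]].
  apply: eq_big_nat => j /andP[jt jt']; rewrite ifF ?Delta_topE //.
  by apply/negbTE; rewrite -ltnNge; lia.
have jd : (j + d ord_max <= t)%N by lia.
by rewrite jd divff // top_det_neq0.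
Qed.

End Graded.

(** * Evaluation at the roots *)

Section Roots.

Variables (n : nat) (d : 'I_n.+1 -> nat) (t : nat).
Hypothesis d_gt0 : forall i, (0 < d i)%N.
Local Notation mon := 'X_{1..n < (tstar d t).+1}.
Variable T : nat -> {set mon}.
Hypothesis admT : admissible T.
Variable S : {set mon}.
Hypothesis degS : forall m, m \in S -> (mdeg m <= t)%N.
Hypothesis cardS : #|S| = hilb_all d t.
Variables (L : closedFieldType) (iota : {rmorphism genK d -> L}).
Variable xi : 'I_(bezout d) -> {ffun 'I_n -> L}.
Hypothesis xi_root : forall i j, evalK iota (gen_poly d (ix i)) (xi j) = 0.

Let entry := @gen_entry n d t.
(** The monomials of degree at most t together with T*. They are split in two ways: into T and its
    complement for the values at the roots, into [low] and the columns of M_S for the rows of M. *)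
Let cols := Tall T :|: cols_init T.
Let low := S :|: Tstar T.
Let last_row (m : mon) : 'I_n.+1 * mon := (ord_max, m).

Lemma last_row_inj : injective last_row.
Proof. by move=> m m' []. Qed.

Lemma mem_cols m : (m \in cols) = (mdeg m <= t)%N || (m \in Tstar T).
Proof.
rewrite !inE mem_Tall // mem_Tstar //.
by case: leqP; case: (m \in T (mdeg m)).
Qed.

Lemma disjoint_Tall_cols_init : [disjoint cols_init T & Tall T].
Proof.
rewrite -setI_eq0; apply/eqP/setP => m; rewrite !inE mem_Tall //.
by case: (m \in T _); rewrite ?andbF.
Qed.

Lemma disjoint_S_Tstar : [disjoint S & Tstar T].
Proof.
rewrite -setI_eq0; apply/eqP/setP => m; rewrite !inE mem_Tstar //.
by case: (boolP (m \in S)) => // /degS; rewrite ltnNge => ->.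
Qed.

Lemma cols_low : cols = cols_M S :|: low.
Proof.
apply/setP => m; rewrite mem_cols !inE.
by case: (boolP (m \in S)) => [/degS ->|_] //=; rewrite andbT.
Qed.

Lemma disjoint_cols_low : [disjoint cols_M S & low].
Proof.
rewrite -setI_eq0; apply/eqP/setP => m; rewrite !inE mem_Tstar //.
by case: (m \in S); case: (leqP (mdeg m) t); rewrite ?andbF.
Qed.

Lemma rows_M_split : rows_M d t = last_row @: Rset d t ord_max :|: rows_init d t.
Proof.
apply/setP => p; rewrite [in RHS]inE [p \in rows_init _ _]inE [p \in rows_M _ _]inE.
have [lt|ge] := ltnP p.1 n.
  rewrite andbT; case: imsetP => //= -[m _ pE].
  by move: lt; rewrite pE /= ltnn.
rewrite andbF orbF; have pmax : p.1 = ord_max.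
  by apply: val_inj; apply/eqP; rewrite eqn_leq ge andbT -ltnS ltn_ord.
apply/idP/imsetP => [pR|[m mR ->]] //.
by exists p.2; rewrite -?pmax //; case: p pR {ge} pmax => /= i m _ ->.
Qed.

Lemma disjoint_rows : [disjoint last_row @: Rset d t ord_max & rows_init d t].
Proof.
rewrite -setI_eq0; apply/eqP/setP => p; rewrite [in RHS]inE [LHS]inE.
apply/andP => -[/imsetP[m _ ->]]; by rewrite inE ltnn andbF.
Qed.

Lemma card_cols : #|cols| = (bezout d + #|cols_init T|)%N.
Proof.
rewrite /cols setUC; have := cardsUI (cols_init T) (Tall T).
by rewrite (disjoint_setI0 disjoint_Tall_cols_init) cards0 addn0 card_Tall // addnC => ->.
Qed.

Lemma card_low_last : (#|low| + #|@Rset n d t ord_max|)%N = bezout d.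
Proof.
have := cardsUI S (Tstar T); rewrite (disjoint_setI0 disjoint_S_Tstar) cards0 addn0.
by rewrite -/low => ->; rewrite cardS -addnA card_O_rows.
Qed.

(** Count [cols] along both of its decompositions, replace the Bezout number by [card_low_last], and
    cancel [#|low|]. *)
Lemma card_rows_M : #|rows_M d t| = #|cols_M S|.
Proof.
have := cardsUI (cols_M S) low; rewrite (disjoint_setI0 disjoint_cols_low).
rewrite cards0 addn0 -cols_low card_cols -card_low_last.
have := cardsUI (last_row @: Rset d t ord_max) (rows_init d t).
rewrite (disjoint_setI0 disjoint_rows) cards0 addn0 -rows_M_split => ->.
rewrite (card_imset _ last_row_inj) (card_rows_init admT).
by rewrite -addnA [RHS]addnC => /addnI.
Qed.

Let pt j (m : mon) : L := ('X_[m]).@[xi j].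

Lemma sum_coef_eval b (p : {mpoly (genK d)[n]}) (x : {ffun 'I_n -> L}) :
    (forall m, (b <= mdeg m)%N -> p@_m = 0) ->
  \sum_(m : 'X_{1..n < b}) iota p@_m * ('X_[m]).@[x] = evalK iota p x.
Proof.
move=> pb; rewrite /evalK [in RHS](@mpolywE _ _ b p).
  rewrite [map_mpoly iota _]raddf_sum [RHS]raddf_sum; apply: eq_bigr => m _ /=.
  by rewrite map_mpolyZ map_mpolyX mevalZ.
rewrite msizeE; apply/bigmax_leqP_seq => m mp _; rewrite ltnNge; apply/negP => /pb.
by apply/eqP; rewrite -mcoeff_msupp.
Qed.

(** A row of M times the values of the monomials evaluates x^a f_i; the monomials outside [cols]
    have degree above t, where the row is zero. *)
Lemma sum_entry_eval p j : p \in rows_M d t ->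
  \sum_(m in cols) iota (entry p m) * pt j m =
    ('X_[p.2]).@[xi j] * evalK iota (gen_poly d p.1) (xi j).
Proof.
rewrite inE inE => /andP[pt_ _].
transitivity (\sum_(m : mon) iota (entry p m) * pt j m).
  rewrite big_mkcond; apply: eq_bigr => m _; rewrite mem_cols; case: ifP => // /norP[+ _].
  rewrite -ltnNge => tm; rewrite /entry gen_entry_eq0 ?rmorph0 ?mul0r //.
  exact: leq_ltn_trans tm.
rewrite sum_coef_eval => [|m mt]; last first.
  apply: mcoeffX_gen_poly; apply: leq_ltn_trans pt_ _.
  by apply: leq_trans mt; rewrite ltnS leq_maxr.
by rewrite /evalK rmorphM /= map_mpolyX mevalM.
Qed.

(** Rows [inl] are the added unit rows and rows [inr] those of M; columns [inl] belong to the roots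
    and columns [inr] are the added unit columns. *)
Let row_type := (mon + ('I_n.+1 * mon))%type.
Let col_type := ('I_(bezout d) + mon)%type.

Let big_mx (r : row_type) (m : mon) : L :=
  match r with inl m' => (m' == m)%:R | inr p => iota (entry p m) end.

Let val_mx (m : mon) (c : col_type) : L :=
  match c with inl j => pt j m | inr m' => (m == m')%:R end.

Let prod_mx (r : row_type) (c : col_type) : L :=
  \sum_(m in cols) big_mx r m * val_mx m c.

Lemma prod_mx_unit m c : m \in cols -> prod_mx (inl m) c = val_mx m c.
Proof.
move=> mc; rewrite /prod_mx (bigD1 m) //= eqxx mul1r big1 ?addr0 // => m' /andP[_ mm'].
by rewrite eq_sym (negbTE mm') mul0r.
Qed.

Lemma prod_mx_entry p m : m \in cols -> prod_mx (inr p) (inr m) = iota (entry p m).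
Proof.
move=> mc; rewrite /prod_mx (bigD1 m) //= eqxx mulr1 big1 ?addr0 // => m' /andP[_ mm'].
by rewrite (negbTE mm') mulr0.
Qed.

Lemma prod_mx_root p j : p \in rows_M d t -> prod_mx (inr p) (inl j) =
  ('X_[p.2]).@[xi j] * evalK iota (gen_poly d p.1) (xi j).
Proof. exact: sum_entry_eval. Qed.

Let all_rows : {set row_type} := inr @: rows_M d t :|: inl @: low.
Let all_cols : {set col_type} := inr @: cols_init T :|: inl @: setT.

(** The unit rows at [low] vanish on the columns of M_S and form an identity block on [low]. *)
Lemma sdet_big_mx : sdet all_rows cols big_mx =±
  iota (sqdet (coef_mx (gen_poly d) (rows_M d t) (cols_M S))).
Proof.
rewrite sqdet_gen_mx sdet_map cols_low /all_rows.
apply: eq_sign_trans.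
  apply: sdet_block; rewrite ?card_inl ?card_inr //.
  - exact: disjoint_inr_inl.
  - exact: disjoint_cols_low.
  - exact: card_rows_M.
  - move=> _ m' /imsetP[m mlow ->] m'M /=.
    case: eqP => // e; have := disjointFr disjoint_cols_low m'M.
    by rewrite -e mlow.
rewrite -[X in _ =± X]mulr1; apply: eq_signM.
  by apply: sdet_imset_rows => p q _ _; apply: inr_inj.
apply: eq_sign_trans; first by apply: sdet_imset_rows => p q _ _; apply: inl_inj.
by apply: eq_signW; apply: sdet_id.
Qed.

(** The unit columns vanish on T and form an identity block on its complement; the rows in T give
    the Vandermonde block. *)
Lemma sdet_val_mx : sdet cols all_cols val_mx =± vandermonde xi T.
Proof.
rewrite /cols setUC /all_cols.
apply: eq_sign_trans.
  apply: sdet_block; rewrite ?card_inl ?card_inr //.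
  - exact: disjoint_Tall_cols_init.
  - exact: disjoint_inr_inl.
  - by rewrite cardsT card_ord card_Tall.
  - move=> m _ mT /imsetP[m' m'C ->] /=.
    case: eqP => // e; have := disjointFr disjoint_Tall_cols_init m'C.
    by rewrite -e mT.
rewrite -[X in _ =± X]mul1r; apply: eq_signM.
  apply: eq_sign_trans; first by apply: sdet_imset_cols => p q _ _; apply: inr_inj.
  by apply: eq_signW; apply: sdet_id.
apply: eq_sign_trans; first by apply: sdet_imset_cols => p q _ _; apply: inl_inj.
rewrite -{1}(setID (Tall T) (Tstar T)).
have -> : Tall T :&: Tstar T = Tstar T.
  by apply/setIidPr/subsetP => m; rewrite mem_Tstar // mem_Tall // => /andP[].
apply: sqdet_set_mx (enumerates_ord _) _.
  apply: enumerates_split; try exact: enumerates_enum_val.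
  by rewrite -setI_eq0 setIDA setIC -setIDA setDv setI0.
by move=> u v; rewrite /split_case mxE; case: splitP => w _; rewrite mxE.
Qed.

(** In the root columns, the unit rows give the values of S and T*, the rows of f_{n+1} their own
    values, and those of f_1, ..., f_n zero. In the unit columns the last group leaves M'. *)
Lemma sdet_prod_mx : sdet all_rows all_cols prod_mx =±
  sqdet (O_mx iota xi S T) * iota (sdet (rows_init d t) (cols_init T) entry).
Proof.
(* The rows of f_{n+1} are regrouped with the unit rows. *)
pose O_rows : {set row_type} := inl @: low :|: inr @: (last_row @: Rset d t ord_max).
have -> : all_rows = O_rows :|: inr @: rows_init d t.
  by rewrite /all_rows rows_M_split imsetU /O_rows setUC setUA.
have -> : all_cols = inl @: setT :|: inr @: cols_init T by rewrite setUC.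
have rows_sub p : p \in rows_init d t -> p \in rows_M d t by rewrite inE => /andP[].
have disj_low :
    [disjoint (inl @: low : {set row_type}) & inr @: (last_row @: Rset d t ord_max)].
  by rewrite disjoint_sym disjoint_inr_inl.
apply: eq_sign_trans.
  apply: sdet_block.
  - rewrite -setI_eq0 setIUl (disjoint_setI0 _) ?set0U; last first.
      by rewrite disjoint_sym disjoint_inr_inl.
    by rewrite setI_eq0 imset_disjoint ?disjoint_rows //; apply: inr_inj.
  - by rewrite disjoint_sym disjoint_inr_inl.
  - have := cardsUI (inl @: low : {set row_type})
      (inr @: (last_row @: Rset d t ord_max)).
    rewrite (disjoint_setI0 disj_low) cards0 addn0 -/O_rows => ->.
    by rewrite !card_inl card_inr (card_imset _ last_row_inj) card_low_last cardsT card_ord.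
  - by rewrite !card_inr (card_rows_init admT).
  - move=> _ _ /imsetP[p pI ->] /imsetP[j _ ->].
    rewrite prod_mx_root ?rows_sub //.
    have [q ->] : exists q, p = widen_row q.
      by apply: widen_rowP; move: pI; rewrite inE => /andP[].
    by rewrite xi_root mulr0.
apply: eq_signM; last first.
  rewrite sdet_map; apply: eq_sign_trans.
    by apply: sdet_imset => p q _ _; apply: inr_inj.
  apply: eq_signW; apply: eq_sdet => p m pI mI.
  by apply: prod_mx_entry; rewrite inE mI orbT.
apply: eq_sign_sym.
have -> : O_rows =
    inl @: S :|: (inl @: Tstar T :|: inr @: (last_row @: Rset d t ord_max)).
  by rewrite setUA /O_rows /low imsetU.
(* The nested numbering follows the nested [col_mx] in [O_mx]: S, then T*, then the rows of
   f_{n+1}. *)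
apply: (@sqdet_enumerates _ _ _ _ _ _ _ _ prod_mx
  (split_case (inl \o enum_val)
    (split_case (inl \o enum_val) (inr \o (last_row \o enum_val)))) inl).
- apply: enumerates_split.
  + by apply: enumerates_comp (enumerates_enum_val _) _ => p q _ _; apply: inl_inj.
  + apply: enumerates_split.
    * by apply: enumerates_comp (enumerates_enum_val _) _ => p q _ _; apply: inl_inj.
    * apply: enumerates_comp => [|p q _ _]; last exact: inr_inj.
      by apply: enumerates_comp (enumerates_enum_val _) _ => p q _ _; apply: last_row_inj.
    * by rewrite disjoint_sym disjoint_inr_inl.
  + rewrite -setI_eq0 setIUr [X in X :|: _]disjoint_setI0 ?set0U.
      by rewrite setI_eq0 disjoint_sym disjoint_inr_inl.
    by rewrite imset_disjoint ?disjoint_S_Tstar //; apply: inl_inj.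
- by apply: enumerates_comp (enumerates_ord _) _ => p q _ _; apply: inl_inj.
- move=> u j; rewrite /O_mx /split_case mxE; case: splitP => v _ /=.
    by rewrite mxE prod_mx_unit // mem_cols degS ?enum_valP.
  rewrite mxE; case: splitP => w _ /=.
    by rewrite mxE prod_mx_unit // mem_cols enum_valP orbT.
  by rewrite mxE prod_mx_root // rows_M_split inE imset_f ?enum_valP.
Qed.

(** Combine the three determinants by multiplicativity and divide by E(t), which turns |M'| into the
    product of the Delta_{T_j}. V_T stays on the left, so it may vanish. *)
Lemma Delta_vandermonde : iota (Delta S) * vandermonde xi T =±
  iota (\prod_(t.+1 - d ord_max <= j < t.+1) Delta_top j (T j)) * sqdet (O_mx iota xi S T).
Proof.
have cols1 : #|all_rows| = #|cols|.
  have := cardsUI (inr @: rows_M d t : {set row_type}) (inl @: low).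
  rewrite (disjoint_setI0 (disjoint_inr_inl _ _)) cards0 addn0 -/all_rows => ->.
  have := cardsUI (cols_M S) low; rewrite (disjoint_setI0 disjoint_cols_low) cards0 addn0.
  by rewrite -cols_low card_inl card_inr card_rows_M => ->.
have cols2 : #|cols| = #|all_cols|.
  have := cardsUI (inr @: cols_init T : {set col_type}) (inl @: setT).
  rewrite (disjoint_setI0 (disjoint_inr_inl _ _)) cards0 addn0 -/all_cols => ->.
  by rewrite card_cols card_inl card_inr cardsT card_ord addnC.
have E := eq_sign_sym (eq_signM sdet_big_mx sdet_val_mx).
rewrite sdet_mul // in E; have {}E := eq_sign_trans E sdet_prod_mx.
have := rmorph_eq_sign iota (sdet_init_div admT).
rewrite rmorphM fmorphV => E'.
rewrite /Delta rmorphM fmorphV mulrAC.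
apply: eq_sign_trans (eq_signM E (eq_sign_refl _)) _.
rewrite -mulrA mulrC; apply: eq_signM E' (eq_sign_refl _).
Qed.

End Roots.

(** V_T can be zero for some admissible T, so the quotient formula is asserted when it is nonzero,
    and the identity cleared of denominators in every case, with the same sign. *)
Theorem theorem3p2 (n : nat) (d : 'I_n.+1 -> nat) (d_gt0 : forall i, (0 < d i)%N)
    (L : closedFieldType) (iota : {rmorphism genK d -> L})
    (algL : forall z : L, algebraicOver iota z)
    (xi : 'I_(bezout d) -> {ffun 'I_n -> L}) (rootsP : lists_common_roots iota xi)
    (t : nat) (T : nat -> {set 'X_{1..n < (tstar d t).+1}}) (admT : admissible T)
    (S : {set 'X_{1..n < (tstar d t).+1}})
    (degS : forall m, m \in S -> (mdeg m <= t)%N) (cardS : #|S| = hilb_all d t) :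
  exists e : bool,
    (vandermonde xi T != 0 ->
       iota (Delta S) =
         (-1) ^+ e
         * iota (\prod_(t.+1 - d ord_max <= j < t.+1) Delta_top j (T j))
         * (sqdet (O_mx iota xi S T) / vandermonde xi T))
    /\ iota (Delta S) * vandermonde xi T =
         (-1) ^+ e
         * iota (\prod_(t.+1 - d ord_max <= j < t.+1) Delta_top j (T j))
         * sqdet (O_mx iota xi S T).
Proof.
have xi_root i j : evalK iota (gen_poly d (ix i)) (xi j) = 0.
  by have [_ /(_ (xi j)) [_ H]] := rootsP; apply: H; exists j.
have [e E] := Delta_vandermonde d_gt0 admT degS cardS xi_root.
exists e; rewrite mulrA in E; split=> // V0.
by rewrite mulrA -E mulfK.
Qed.
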